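(* Let $R:\mathbb{R}^n\to\mathbb{R}$ be continuously differentiable and let $\gamma>0$ satisfy (a) $\mathcal{E}(R,\gamma)\subset\mathcal{D}$ is compact and $0\in\mathcal{E}(R,\gamma)$; (b) $-\langle\nabla R(x),f(x)\rangle>0$ for all $x\in\partial\mathcal{E}(R,\gamma)$. Suppose there exists a continuously differentiable $V_N:\mathbb{R}^n\to\mathbb{R}$ with $V_N(0)=0$ such that (c) $V_N(x)>0$ for all $x\in\mathcal{E}(R,\gamma)\setminus\{0\}$; (d) $-\langle\nabla V_N(x),f(x)\rangle>0$ for all $x\in\mathcal{E}(R,\gamma)\setminus\{0\}$. Then: (I) for every $x_0\in\mathcal{E}(R,\gamma)$ the solution $x(t)=\phi(t,x_0)$ of $\dot x=f(x)$ satisfies $x(t')\in\mathcal{S}$ for all $t'\in[0,\infty)$. Moreover, if $R$, $\gamma$ and $V_N$ (continuously differentiable, $V_N(0)=0$) are such that (a) and (c) hold, that $$-\big\langle \nabla V_N(x)(\gamma-R(x))+V_N(x)\nabla R(x),\,f(x)\big\rangle>0\quad\text{for all }x\in\mathcal{E}(R,\gamma)\setminus\{0\},$$ and that there exists a scalar $\bar\epsilon>0$ with $0\notin\mathcal{E}(R,\gamma)\setminus\mathcal{E}^\circ(R,\gamma-\bar\epsilon)$, then: (II) the function $$V(x)=\frac{V_N(x)}{\gamma-R(x)}$$ is a Lyapunov function for $\dot x=f(x)$ on $\mathcal{E}^\circ(R,\gamma)$, and $\mathcal{E}^\circ(R,\gamma)$ is an estimate of $\mathcal{S}$, i.e. 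$\mathcal{E}^\circ(R,\gamma)\subseteq\mathcal{S}$.
   Context: Consider the system $\dot x=f(x)$, where $f:\mathcal{D}\to\mathbb{R}^n$ is locally Lipschitz on a domain (open connected set) $\mathcal{D}\subset\mathbb{R}^n$ with $0\in\mathcal{D}$ and $f(0)=0$. $\phi(t,x_0)$ denotes the solution with initial condition $x_0$ at time $t=0$. The region of attraction of the origin is $$\mathcal{S}=\{x\in\mathbb{R}^n : \phi(t,x)\text{ is defined for all }t\ge0\text{ and }\lim_{t\to\infty}\phi(t,x)=0\}.$$ For a function $R:\mathbb{R}^n\to\mathbb{R}$ and a real $c$: $\mathcal{E}(R,c)=\{x\in\mathbb{R}^n: R(x)\le c\}$ and $\mathcal{E}^\circ(R,c)=\{x\in\mathbb{R}^n:R(x)<c\}$. $\partial\mathcal{X}$ denotes the (topological) boundary of a set $\mathcal{X}$. ''$V$ is a Lyapunov function on $\mathcal{E}^\circ(R,\gamma)$'' means: $V$ is continuously differentiable there, $V(0)=0$, and $V(x)>0$ and $\dot V(x)=\langle\nabla V(x),f(x)\rangle<0$ for all $x\in\mathcal{E}^\circ(R,\gamma)\setminus\{0\}$. *)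

(* Defs.v *)
(* MathComp-Analysis; the real line is an arbitrary [K : realType] and R^n is
   ['rV[K]_n]. *)
From HB Require Import structures.
From mathcomp Require Import all_boot all_order all_algebra.
From mathcomp Require Import all_classical all_reals all_analysis.

Set Implicit Arguments.
Unset Strict Implicit.
Unset Printing Implicit Defensive.

Import Order.TTheory GRing.Theory Num.Theory.
Import numFieldNormedType.Exports.

Local Open Scope classical_set_scope.
Local Open Scope ring_scope.

Definition inner (K : realType) (n : nat) (u v : 'rV[K]_n) : K :=
  \sum_(i < n) u ord0 i * v ord0 i.

Definition gradient (K : realType) (n : nat) (g : 'rV[K]_n -> K)
    (x : 'rV[K]_n) : 'rV[K]_n :=
  \row_(i < n) 'D_(delta_mx ord0 i) g x.

(* Meant for open [A]: differentiability and continuity of the gradient are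
   taken with respect to full neighbourhoods of the points of [A]. *)
Definition continuously_differentiable (K : realType) (n : nat)
    (A : set 'rV[K]_n) (g : 'rV[K]_n -> K) : Prop :=
  forall x, A x -> differentiable g x /\ {for x, continuous (gradient g)}.

Definition locally_lipschitz (K : realType) (n : nat) (D : set 'rV[K]_n)
    (f : 'rV[K]_n -> 'rV[K]_n) : Prop :=
  forall x, D x -> exists2 U, nbhs x U & [lipschitz f z | z in U `&` D].

Definition boundary (T : topologicalType) (A : set T) : set T :=
  closure A `\` interior A.

Definition sublevel (K : realType) (n : nat) (R : 'rV[K]_n -> K) (c : K) :
    set 'rV[K]_n :=
  [set x | R x <= c].

Definition strict_sublevel (K : realType) (n : nat) (R : 'rV[K]_n -> K)
    (c : K) : set 'rV[K]_n :=
  [set x | R x < c].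

(* [x] solves [x' = f x], [x 0 = x0] on [0, T] (for [0 <= T]) while staying in
   the domain [D] of the vector field; the values of [f] outside [D] are
   irrelevant. As [f] is continuous on [D], the one-sided differential equations
   at [0] and [T] follow from the continuity of [x] on the closed interval. *)
Definition is_solution (K : realType) (n : nat) (f : 'rV[K]_n -> 'rV[K]_n)
    (D : set 'rV[K]_n) (x0 : 'rV[K]_n) (T : K) (x : K -> 'rV[K]_n) : Prop :=
  [/\ x 0 = x0,
      forall t, t \in `[0, T] -> D (x t),
      {within `[0, T], continuous x} &
      forall t, t \in `]0, T[ -> is_derive t 1 x (f (x t))].

(* The set of values at time [t] of the solutions on [0, t] starting at [x0]:
   for [f] locally Lipschitz on an open [D] it has at most one element, which
   is phi(t, x0). *)
Definition flow_values (K : realType) (n : nat) (f : 'rV[K]_n -> 'rV[K]_n)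
    (D : set 'rV[K]_n) (t : K) (x0 : 'rV[K]_n) : set 'rV[K]_n :=
  [set y | exists2 x, is_solution f D x0 t x & x t = y].

Definition flow_defined (K : realType) (n : nat) (f : 'rV[K]_n -> 'rV[K]_n)
    (D : set 'rV[K]_n) (t : K) (x0 : 'rV[K]_n) : Prop :=
  flow_values f D t x0 !=set0.

(* phi(t, x0), with the junk value [0] when it is not defined. *)
Definition flow (K : realType) (n : nat) (f : 'rV[K]_n -> 'rV[K]_n)
    (D : set 'rV[K]_n) (t : K) (x0 : 'rV[K]_n) : 'rV[K]_n :=
  xget 0 (flow_values f D t x0).

Definition region_of_attraction (K : realType) (n : nat)
    (f : 'rV[K]_n -> 'rV[K]_n) (D : set 'rV[K]_n) : set 'rV[K]_n :=
  [set x | (forall t, 0 <= t -> flow_defined f D t x) /\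
           flow f D t x @[t --> +oo] --> (0 : 'rV[K]_n)].

Definition is_lyapunov (K : realType) (n : nat) (f : 'rV[K]_n -> 'rV[K]_n)
    (A : set 'rV[K]_n) (V : 'rV[K]_n -> K) : Prop :=
  [/\ continuously_differentiable A V,
      V 0 = 0 &
      forall x, (A `\` [set 0]) x -> 0 < V x /\ inner (gradient V x) (f x) < 0].

(* Main.v *)
Require Import Defs.
From HB Require Import structures.
From mathcomp Require Import all_boot all_order all_algebra.
From mathcomp Require Import all_classical all_reals all_analysis.
From mathcomp Require Import ring lra.

Set Implicit Arguments.
Unset Strict Implicit.
Unset Printing Implicit Defensive.

Import Order.TTheory GRing.Theory Num.Theory.
Import numFieldNormedType.Exports.

Local Open Scope classical_set_scope.
Local Open Scope ring_scope.

(** Both parts rest on the same two mechanisms.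

    Trapping.  At a point of the boundary of E = {R <= c} the derivative of R
    along the vector field is negative.  At the last instant at which a solution
    starting in E has not yet left E, it sits at such a point, and the mean value
    theorem applied to R along the solution shows that R is smaller, not larger,
    just afterwards; hence no solution leaves E ([sublevel_invariant]).

    Attraction.  Let a compact set A contain all the solutions from x0, let V be
    positive and its derivative along f negative on A away from 0.  By
    compactness, given e there are c, m > 0 such that V > c wherever |y| >= e and
    the derivative is below -m wherever V >= c.  A solution still at distance e
    from 0 at time T has lost at least m T from V x0, so T <= V x0 / m
    ([lyapunov_convergence]).  This bound is the same for all solutions from x0,
    so convergence of the flow never calls for uniqueness of solutions.

    Existence on [0, T] for every T is obtained in one stroke, without gluing
    local solutions.  A locally Lipschitz f is Lipschitz on the compact E
    ([lipschitz_on_compact]); extend its restriction to a Lipschitz field g on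
    the whole space ([lipschitz_extension]) and solve x' = g(x) globally by
    Picard iteration ([exists_global_solution]).  Since g = f on E, the trapping
    argument applies to g as well: the solution stays in E, where it solves
    x' = f(x).

    In the first part V is VN and A is E.  In the second part, on {R = gamma}
    the hypothesis reduces to VN <grad R, f> < 0 with VN > 0, because R 0 < gamma
    by the condition on epsilon; so trapping holds, and run backwards from a
    contact with {R = gamma} it even keeps solutions strictly inside.  There
    V = VN / (gamma - R) is defined, and the quotient rule turns the hypothesis
    into the negativity of its derivative along f.  As V does not increase
    along a solution, the solution remains in
    A = {y in E | VN y <= V x0 (gamma - R y)}, which is compact and does not
    meet {R = gamma}. *)

(** * Row vectors and their coordinates *)

Lemma coord_le_norm (K : realType) (n : nat) (v : 'rV[K]_n) (i : 'I_n) :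
  `|v ord0 i| <= `|v|.
Proof.
by rewrite [leRHS]/Num.Def.normr/= mx_normrE; exact: (le_bigmax _ _ (ord0, i)).
Qed.

Lemma norm_le_coord (K : realType) (n : nat) (v : 'rV[K]_n) (e : K) :
  0 <= e -> (forall i, `|v ord0 i| <= e) -> `|v| <= e.
Proof.
move=> e0 ve; rewrite /Num.Def.normr/= mx_normrE bigmax_le// => -[i j] _ /=.
by rewrite ord1.
Qed.

Lemma continuous_coord (K : realType) (n : nat) (T : topologicalType)
    (u : T -> 'rV[K]_n) (t : T) :
  {for t, continuous u} <-> forall i, {for t, continuous (fun s => u s ord0 i)}.
Proof.
split=> [cu i|cu].
  exact: (continuous_comp cu (@coord_continuous K 1 n ord0 i (u t))).
apply/cvgrPdist_le => e e0.
have : \forall s \near t, forall i : 'I_n, `|u t ord0 i - u s ord0 i| <= e.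
  by apply: filter_forall => i; move/cvgrPdist_le : (cu i); exact.
apply: filterS => s us; apply: norm_le_coord; first exact: ltW.
by move=> i; rewrite !mxE.
Qed.

Lemma is_derive_coord (K : realType) (n : nat) (u : K -> 'rV[K]_n) (t : K)
    (v : 'rV[K]_n) :
  is_derive t 1 u v <-> forall i, is_derive t 1 (fun s => u s ord0 i) (v ord0 i).
Proof.
split=> [[du uv] i|du].
  split; first by move/derivable_mxP : du; exact.
  by rewrite -uv derive_mx// mxE.
have dU : derivable u t 1.
  apply/derivable_mxP => i j; rewrite ord1.
  exact: (@ex_derive _ _ _ _ _ _ _ (du j)).
split=> //; rewrite derive_mx//; apply/rowP => j; rewrite mxE.
exact: (@derive_val _ _ _ _ _ _ _ (du j)).
Qed.

(** * Antiderivatives and growth estimates *)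

Lemma continuous_maxr0 (K : realType) : continuous (fun t : K => Num.max t 0).
Proof.
move=> t; apply: (@continuous_max K K id (cst 0)); first exact: cvg_id.
exact: cvg_cst.
Qed.

(** Clamping the argument at 0 makes the antiderivative continuous on the whole
    line while keeping its derivative at positive times, which is all that
    Picard iteration on [0, +oo[ needs. *)
Lemma exists_antiderivative (K : realType) (h : K -> K) : continuous h ->
  exists F : K -> K, [/\ continuous F, F 0 = 0 &
    forall t : K, 0 < t -> is_derive t 1 F (h t)].
Proof.
move=> ch.
(* starting the integral at -1 makes 0 an interior point of its domain *)
pose G (x : K) := \int[lebesgue_measure]_(t in `[-1, x]) h t.
have dG (t : K) : -1 < t -> is_derive t 1 G (h t).
  move=> t1; have [|||dG DG] := @continuous_FTC1_closed K h (-1) t (t + 1) _ _ t1.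
  - by rewrite ltrDl.
  - apply: continuous_compact_integrable; first exact: segment_compact.
    exact: continuous_subspaceT.
  - exact: ch.
  by split=> //; rewrite -derive1E.
exists (fun t => G (Num.max t 0) - G 0); split.
- move=> t; apply: cvgB; last exact: cvg_cst.
  apply: (@cvg_comp _ _ _ (fun t => Num.max t 0) G _ (nbhs (Num.max t 0))).
    exact: continuous_maxr0.
  apply: differentiable_continuous; apply/derivable1_diffP.
  apply: (@ex_derive _ _ _ _ _ _ _ (dG _ _)).
  by rewrite (@lt_le_trans _ _ 0) ?ltrN10// le_max lexx orbT.
- by rewrite maxxx subrr.
- move=> t t0.
  have dGt : is_derive t 1 (fun s => G s - G 0) (h t).
    have ? := dG t (lt_trans (ltrN10 _) t0).
    by rewrite -[h t]subr0; apply: is_deriveB.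
  apply: near_eq_is_derive dGt; near=> s.
  by rewrite max_l// ltW//; near: s; exact: lt_nbhsr.
Unshelve. all: by end_near. Qed.

(** The differential form of the estimate of Picard iterates in the norm weighted
    by exp (- c t): a bound of the derivative by that of A exp (c t) integrates to
    a bound by A exp (c t), without handling any integral. *)
Lemma exp_growth_bound (K : realType) (g dg : K -> K) (A c : K) :
  continuous g -> `|g 0| <= A ->
  (forall t : K, 0 < t -> is_derive t 1 g (dg t)) ->
  (forall t, 0 < t -> `|dg t| <= A * (c * expR (c * t))) ->
  forall t, 0 <= t -> `|g t| <= A * expR (c * t).
Proof.
move=> cg g0A Dg dgA t; rewrite le_eqVlt => /predU1P[<-|t0].
  by rewrite mulr0 expR0 mulr1.
have De (s : K) : is_derive s 1 (fun s => expR (c * s)) (c * expR (c * s)).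
  rewrite mulrC; apply: (@is_derive1_comp _ expR (fun s => c * s)).
  by rewrite -[X in is_derive _ _ _ X]mulr1; exact: (@is_deriveZ _ _ _ id).
have cexp : continuous (fun s : K => expR (c * s)).
  move=> s; apply/differentiable_continuous/derivable1_diffP.
  exact: (@ex_derive _ _ _ _ _ _ _ (De s)).
(* A exp (c t) - g and A exp (c t) + g are nondecreasing *)
have main (e : K) : `|e| = 1 -> 0 <= A * expR (c * t) - e * g t.
  move=> e1.
  have Dh (s : K) : s \in `]0, t[ -> is_derive s 1
      (fun s => A * expR (c * s) - e * g s)
      (A * (c * expR (c * s)) - e * dg s).
    rewrite in_itv/= => /andP[s0 _]; have ? := Dg s s0; have ? := De s.
    exact: is_deriveB.
  have ch : {within `[0, t], continuous (fun s => A * expR (c * s) - e * g s)}.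
    apply: continuous_subspaceT => s; apply: cvgB; apply: cvgM; try exact: cvg_cst.
      exact: cexp.
    exact: cg.
  have [s] := MVT t0 Dh ch.
  rewrite in_itv/= => /andP[s0 _]; rewrite mulr0 expR0 mulr1 subr0 => hE.
  rewrite -[leRHS](subrK (A - e * g 0)) hE addr_ge0//.
    rewrite mulr_ge0 ?(ltW t0)// subr_ge0 (le_trans (ler_norm _))//.
    by rewrite normrM e1 mul1r dgA.
  by rewrite subr_ge0 (le_trans (ler_norm _))// normrM e1 mul1r.
rewrite ler_norml -subr_ge0 opprK -(subr_ge0 (g t)).
have := main 1 (normr1 _); rewrite mul1r => ->.
by have := main (-1) (normrN1 _); rewrite mulN1r opprK addrC => ->.
Qed.

Lemma near_geometric_lt (K : realType) (b e : K) :
  0 < e -> \forall k \near \oo, b / 2 ^+ k < e.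
Proof.
move=> e0.
have : b *: (geometric 1 2^-1 : nat -> K) k @[k --> \oo] --> b *: (0 : K).
  apply: cvgZr; apply: cvg_geometric; rewrite ger0_norm ?invr_ge0//.
  by rewrite invf_lt1// ltr1n.
rewrite scaler0 => /cvgrPdist_lt /(_ e e0); apply: filterS => k.
rewrite sub0r normrN /geometric/= mul1r exprVn; apply: le_lt_trans.
exact: ler_norm.
Qed.

Lemma geometric_cauchy (K : realType) (n : nat) (u : nat -> 'rV[K]_n) (a : K) :
  (forall k, `|u k.+1 - u k| <= a / 2 ^+ k) ->
  exists l, forall k, `|u k - l| <= a *+ 2 / 2 ^+ k.
Proof.
move=> ua.
have a0 : 0 <= a by have := ua 0%N; rewrite expr0 divr1; exact: le_trans.
have uu k j : `|u k - u (k + j)%N| <= a *+ 2 / 2 ^+ k - a *+ 2 / 2 ^+ (k + j).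
  elim: j => [|j IH]; first by rewrite addn0 !subrr normr0.
  rewrite -(subrKA (u (k + j)%N)) (le_trans (ler_normD _ _))//.
  have := lerD IH (ua (k + j)%N).
  rewrite addnS -[`|u _.+1 - _|]normrN opprB; move/le_trans; apply.
  rewrite -addrA lerD2l exprS invfM mulrA -[a *+ 2]mulr_natr mulfK//.
  by rewrite mulr_natr mulr2n mulrDl; lra.
have uk k m : (k <= m)%N -> `|u k - u m| <= a *+ 2 / 2 ^+ k.
  move=> km; rewrite -(subnKC km) (le_trans (uu _ _))// gerBl.
  by rewrite divr_ge0// ?exprn_ge0// mulrn_wge0.
have : cvg (u @ \oo).
  apply: cauchy_cvg; apply: cauchy_exP => e e0.
  have [k _ kP] := near_geometric_lt (a *+ 2) e0.
  exists (u k); exists k => // m /= km.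
  rewrite -ball_normE/=; apply: le_lt_trans (uk _ _ km) (kP k (leqnn k)).
move=> /cvg_ex[l ul]; exists l => k.
apply/ler_addgt0Pr => e e0.
move/cvgrPdist_le : ul => /(_ e e0)[m _ mP].
rewrite -(subrKA (u (maxn k m))) (le_trans (ler_normD _ _))// lerD//.
  by apply: uk; rewrite leq_maxl.
by rewrite distrC; apply: mP => /=; rewrite leq_maxr.
Qed.

(** * Lipschitz maps: continuity, compact sets, extension *)

Lemma klipschitz_continuous (K : realType) (V W : normedModType K) (g : V -> W)
    (L : K) :
  (forall u v, `|g u - g v| <= L * `|u - v|) -> continuous g.
Proof.
move=> gL u; apply/cvgrPdist_le => e e0.
have L1 : 0 < Num.max L 1 by rewrite lt_max ltr01 orbT.
have /cvgrPdist_le/(_ _ (divr_gt0 e0 L1)) : v @[v --> u] --> u by exact: cvg_id.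
apply: filterS => v uv; rewrite (le_trans (gL _ _))//.
rewrite (@le_trans _ _ (Num.max L 1 * `|u - v|))//.
  by rewrite ler_wpM2r// le_max lexx.
by rewrite mulrC -ler_pdivlMr.
Qed.

Lemma locally_lipschitz_continuous (K : realType) (V W : normedModType K)
    (D : set V) (f : V -> W) (x : V) :
  open D ->
  (forall x, D x -> exists2 U, nbhs x U & [lipschitz f z | z in U `&` D]) ->
  D x -> {for x, continuous f}.
Proof.
move=> oD fl Dx; have [U Ux [M [_ /(_ (Num.max M 0 + 1)) MP]]] := fl x Dx.
have M1 : 0 < Num.max M 0 + 1 by rewrite ltr_wpDl// le_max lexx orbT.
have /MP {}MP : M < Num.max M 0 + 1 by rewrite ltr_pwDr// le_max lexx.
have UDx : nbhs x (U `&` D) by apply: filterI => //; exact: open_nbhs_nbhs.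
apply/cvgrPdist_le => e e0.
have /cvgrPdist_le/(_ _ (divr_gt0 e0 M1)) : v @[v --> x] --> x by exact: cvg_id.
apply: filterS2 UDx => v UDv xv.
rewrite (le_trans (MP (x, v) (conj _ UDv)))//=.
  by split=> //; exact: nbhs_singleton.
by rewrite mulrC -ler_pdivlMr.
Qed.

(** The inequality |f u - f v| <= L |u - v| holds for L large near every point of
    E x E: on the diagonal because f is locally Lipschitz, off the diagonal because
    the difference quotient is continuous there.  Compactness of E x E gives a
    common L. *)
Lemma lipschitz_on_compact (K : realType) (V W : normedModType K)
    (D E : set V) (f : V -> W) :
  open D ->
  (forall x, D x -> exists2 U, nbhs x U & [lipschitz f z | z in U `&` D]) ->
  E `<=` D -> compact E ->
  exists2 L : K, 0 < L & forall x y, E x -> E y -> `|f x - f y| <= L * `|x - y|.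
Proof.
move=> oD fl ED cE.
have /compact_near_coveringP cEE := compact_setX cE cE.
pose P (L : K) (z : V * V) :=
  E z.1 -> E z.2 -> `|f z.1 - f z.2| <= L * `|z.1 - z.2|.
have : \forall L \near +oo, (E `*` E) `<=` P L.
  apply: cEE => -[x y] [/= Ex Ey].
  have [xy|xy] := eqVneq x y.
    have [U Ux Ulip] := fl x (ED _ Ex).
    exists (U `*` U, fun L => forall z, ((U `&` D) `*` (U `&` D)) z ->
        `|f z.1 - f z.2| <= L * `|z.1 - z.2|).
      split=> /=; first by exists (U, U) => //=; rewrite -xy.
      exact: Ulip.
    move=> -[[u v] L]/= [[Uu Uv] LP] Eu Ev; apply: (LP (u, v)).
    by split; split=> //; exact: ED.
  (* off the diagonal the difference quotient is continuous *)
  have cf := locally_lipschitz_continuous oD fl.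
  pose q (z : V * V) := `|f z.1 - f z.2| / `|z.1 - z.2|.
  have d0 : `|x - y| != 0 by rewrite normr_eq0 subr_eq0.
  have cd : {for (x, y),
      continuous (fun z : V * V => `|z.1 - z.2|)}.
    by apply: cvg_norm; apply: cvgB; [exact: cvg_fst|exact: cvg_snd].
  have cq : {for (x, y), continuous q}.
    apply: cvgM; last exact: cvgV.
    apply: cvg_norm; apply: cvgB.
      by apply: cvg_comp; [exact: cvg_fst|exact: cf (ED _ Ex)].
    by apply: cvg_comp; [exact: cvg_snd|exact: cf (ED _ Ey)].
  have d1 : \forall z \near (x, y), 0 < `|z.1 - z.2|.
    by apply: cvgr_gt cd _ _; rewrite lt_neqAle eq_sym d0 /=.
  have q1 : \forall z \near (x, y), q z < q (x, y) + 1.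
    by apply: cvgr_lt cq _ _; rewrite ltrDl.
  exists ([set z | 0 < `|z.1 - z.2|] `&` [set z | q z < q (x, y) + 1],
      [set L | q (x, y) + 1 <= L]).
    by split=> /=; [exact: filterI|apply: nbhs_pinfty_ge; rewrite num_real].
  move=> -[z L]/= [[dz qz] qL] _ _.
  by rewrite -ler_pdivrMr// -/(q z) (le_trans (ltW qz)).
move=> [M [_ MP]]; exists (Num.max M 0 + 1).
  by rewrite ltr_wpDl// le_max lexx orbT.
move=> x y Ex Ey; apply: (MP (Num.max M 0 + 1) _ (x, y)) => //.
by rewrite ltr_pwDr// le_max lexx.
Qed.

(** McShane's extension: the infimum over y in E of the cones
    x |-> h y + L |x - y|, each of them L-Lipschitz. *)
Lemma lipschitz_extension_scalar (K : realType) (V : normedModType K)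
    (E : set V) (h : V -> K) (L : K) :
  0 <= L -> E !=set0 ->
  (forall x y, E x -> E y -> `|h x - h y| <= L * `|x - y|) ->
  exists k : V -> K, (forall x, E x -> k x = h x) /\
    (forall x y, `|k x - k y| <= L * `|x - y|).
Proof.
move=> L0 [e Ee] hL.
pose A x := [set h y + L * `|x - y| | y in E].
have A0 x : A x !=set0 by exists (h e + L * `|x - e|); exists e.
have lbA x y : E y -> lbound (A x) (h y - L * `|x - y|).
  move=> Ey _ [z Ez <-]; rewrite lerBlDr -addrA -mulrDr -lerBlDl.
  rewrite (le_trans (ler_norm _))// (le_trans (hL _ _ Ey Ez))// ler_wpM2l//.
  by rewrite (le_trans (ler_distD x _ _))// addrC (distrC y x).
have hA x : has_lbound (A x) by exists (h e - L * `|x - e|); exact: lbA.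
have kle x y : inf (A x) <= inf (A y) + L * `|x - y|.
  rewrite -lerBlDr; apply: lb_le_inf => // _ [z Ez <-].
  rewrite lerBlDr (@le_trans _ _ (h z + L * `|x - z|))//.
    by apply: ge_inf => //; exists z.
  rewrite -addrA lerD2l -mulrDr ler_wpM2l// [leRHS]addrC.
  exact: ler_distD.
exists (fun x => inf (A x)); split=> [x Ex|x y].
  apply/eqP; rewrite eq_le; apply/andP; split.
    by apply: ge_inf => //; exists x => //; rewrite subrr normr0 mulr0 addr0.
  apply: lb_le_inf => //.
  by have := lbA x x Ex; rewrite subrr normr0 mulr0 subr0.
rewrite ler_norml; apply/andP; split; last by rewrite lerBlDl kle.
by rewrite lerBrDl lerBlDr distrC kle.
Qed.

Lemma lipschitz_extension (K : realType) (V : normedModType K) (n : nat)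
    (E : set V) (f : V -> 'rV[K]_n) (L : K) :
  0 <= L -> E !=set0 ->
  (forall x y, E x -> E y -> `|f x - f y| <= L * `|x - y|) ->
  exists g : V -> 'rV[K]_n, (forall x, E x -> g x = f x) /\
    (forall x y, `|g x - g y| <= L * `|x - y|).
Proof.
move=> L0 E0 fL.
have /choice[k kP] : forall i, exists k : V -> K,
    (forall x, E x -> k x = f x ord0 i) /\
    (forall x y, `|k x - k y| <= L * `|x - y|).
  move=> i; apply: (lipschitz_extension_scalar L0 E0) => x y Ex Ey.
  have := coord_le_norm (f x - f y) i; rewrite !mxE => /le_trans; apply.
  exact: fL.
exists (fun x => \row_i k i x); split=> [x Ex|x y].
  by apply/rowP => i; rewrite mxE (kP i).1.
apply: norm_le_coord; first by rewrite mulr_ge0.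
by move=> i; rewrite !mxE; exact: (kP i).2.
Qed.

(** * Picard's theorem for globally Lipschitz vector fields *)

(** The graph of the Picard operator.  The derivative is asked at positive times
    only: the iterates are arbitrary continuous functions on negative times. *)
Definition picard_step (K : realType) (n : nat) (g : 'rV[K]_n -> 'rV[K]_n)
    (x0 : 'rV[K]_n) (x y : K -> 'rV[K]_n) : Prop :=
  [/\ continuous y, y 0 = x0 &
      forall t : K, 0 < t -> is_derive t 1 y (g (x t))].

Lemma exists_picard_step (K : realType) (n : nat) (g : 'rV[K]_n -> 'rV[K]_n)
    (x0 : 'rV[K]_n) (x : K -> 'rV[K]_n) :
  continuous g -> continuous x -> exists y, picard_step g x0 x y.
Proof.
move=> cg cx.
have cgx i : continuous (fun t => g (x t) ord0 i).
  move=> t; apply: (continuous_coord (g \o x) t).1.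
  exact: continuous_comp (cx t) (cg _).
have [F FP] := choice (fun i => exists_antiderivative (cgx i)).
exists (fun t => x0 + \row_i F i t); split.
- move=> t; apply/continuous_coord => i.
  under [X in {for _, continuous X}]eq_fun do rewrite !mxE.
  by apply: cvgD; [exact: cvg_cst|have [cF _ _] := FP i; exact: cF].
- by apply/rowP => i; rewrite !mxE; have [_ -> _] := FP i; rewrite addr0.
- move=> t t0; apply/is_derive_coord => i.
  under [X in is_derive _ _ X]eq_fun do rewrite !mxE.
  have [_ _ /(_ t t0) ?] := FP i.
  by rewrite -[X in is_derive _ _ _ X]add0r; exact: is_deriveD.
Qed.

(** In the norm weighted by exp (- 2 L t) the Picard operator halves distances on
    all of [0, +oo[, so no restriction to short time intervals arises. *)
Lemma picard_step_contraction (K : realType) (n : nat)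
    (g : 'rV[K]_n -> 'rV[K]_n) (L : K) (x0 : 'rV[K]_n)
    (x1 x2 y1 y2 : K -> 'rV[K]_n) (a : K) :
  0 < L -> (forall u v, `|g u - g v| <= L * `|u - v|) ->
  picard_step g x0 x1 y1 -> picard_step g x0 x2 y2 ->
  (forall t, 0 <= t -> `|x1 t - x2 t| <= a * expR (2 * L * t)) ->
  forall t, 0 <= t -> `|y1 t - y2 t| <= a / 2 * expR (2 * L * t).
Proof.
move=> L0 gL [cy1 y10 Dy1] [cy2 y20 Dy2] xa t t0.
have a0 : 0 <= a.
  by have := xa 0 (lexx _); rewrite mulr0 expR0 mulr1; exact: le_trans.
apply: norm_le_coord; first by rewrite mulr_ge0 ?expR_ge0 ?divr_ge0.
move=> i; rewrite !mxE.
pose d s := y1 s ord0 i - y2 s ord0 i.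
apply: (@exp_growth_bound K d (fun s => g (x1 s) ord0 i - g (x2 s) ord0 i)) => //.
- move=> s; apply: cvgB.
    exact: (continuous_coord y1 s).1 (cy1 s) i.
  exact: (continuous_coord y2 s).1 (cy2 s) i.
- by rewrite /d y10 y20 subrr normr0 divr_ge0.
- move=> s s0; have /is_derive_coord/(_ i) ? := Dy1 s s0.
  by have /is_derive_coord/(_ i) ? := Dy2 s s0; exact: is_deriveB.
- move=> s s0; have := coord_le_norm (g (x1 s) - g (x2 s)) i; rewrite !mxE.
  move=> /le_trans; apply; apply: le_trans (gL _ _) _.
  have := ler_wpM2l (ltW L0) (xa s (ltW s0)); move=> /le_trans; apply.
  have -> : L * (a * expR (2 * L * s)) = a / 2 * (2 * L * expR (2 * L * s)).
    by field.
  by [].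
Qed.

(** The Picard iterates converge pointwise at a geometric rate, locally uniformly
    in time, so their limit x is continuous; one more Picard step y starting from
    x is the limit of the same iterates, hence y = x on [0, +oo[ and y is the
    solution. *)
Theorem exists_global_solution (K : realType) (n : nat)
    (g : 'rV[K]_n -> 'rV[K]_n) (L : K) (x0 : 'rV[K]_n) :
  0 < L -> (forall u v, `|g u - g v| <= L * `|u - v|) ->
  exists x, [/\ continuous x, x 0 = x0 &
    forall t : K, 0 < t -> is_derive t 1 x (g (x t))].
Proof.
move=> L0 gL.
have cg : continuous g by exact: klipschitz_continuous gL.
have [P PP] : exists P, forall x, continuous x -> picard_step g x0 x (P x).
  have /choice[P PP] : forall x : K -> 'rV[K]_n,
      exists y, continuous x -> picard_step g x0 x y.
    move=> x; have [cx|ncx] := pselect (continuous x); last by exists x.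
    by have [y xy] := exists_picard_step x0 cg cx; exists y.
  by exists P.
pose u k := iter k P (cst x0).
have cu k : continuous (u k).
  by elim: k => [|k IH] /=; [exact: cst_continuous|case: (PP _ IH)].
have uP k : picard_step g x0 (u k) (u k.+1) by exact: PP.
pose a := `|g x0| / (2 * L).
have a0 : 0 <= a by rewrite divr_ge0// mulr_ge0// ltW.
have exp_ge1 (t : K) : 0 <= t -> 1 <= expR (2 * L * t).
  by move=> t0; rewrite -[1]expR0 ler_expR mulr_ge0// mulr_ge0// ltW.
have u01 (t : K) : 0 <= t -> `|u 1%N t - u 0%N t| <= a * expR (2 * L * t).
  move=> t0; apply: norm_le_coord; first by rewrite mulr_ge0 ?expR_ge0.
  move=> i; rewrite !mxE.
  have [cu1 u10 Du1] := uP 0%N.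
  pose d s := u 1%N s ord0 i - x0 ord0 i.
  apply: (@exp_growth_bound K d (fun s => g x0 ord0 i)) => //.
  + move=> s; apply: cvgB; last exact: cvg_cst.
    exact: (continuous_coord (u 1%N) s).1 (cu1 s) i.
  + by rewrite /d u10 subrr normr0.
  + move=> s s0; have /is_derive_coord/(_ i) ? := Du1 s s0.
    by rewrite -[X in is_derive _ _ _ X]subr0; exact: is_deriveB.
  + move=> s s0; rewrite mulrA /a divfK ?mulf_neq0 ?(gt_eqF L0)//.
    rewrite (le_trans (coord_le_norm _ _))// ler_peMr//.
    exact: exp_ge1 (ltW s0).
have du k (t : K) : 0 <= t -> `|u k.+1 t - u k t| <= a / 2 ^+ k * expR (2 * L * t).
  elim: k t => [|k IH] t t0; first by rewrite expr0 divr1; exact: u01.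
  rewrite exprSr invfM mulrA.
  exact: (picard_step_contraction L0 gL (uP k.+1) (uP k)).
(* clamping makes the limit constant, hence continuous, on negative times *)
have /choice[x xP] : forall t : K, exists l, forall k,
    `|u k (Num.max t 0) - l| <=
      (a * expR (2 * L * Num.max t 0)) *+ 2 / 2 ^+ k.
  move=> t; apply: geometric_cauchy => k; rewrite mulrAC.
  by apply: du; rewrite le_max lexx orbT.
have ux k (t : K) : 0 <= t -> `|u k t - x t| <= (a *+ 2) / 2 ^+ k * expR (2 * L * t).
  move=> t0; have := xP t k; rewrite max_l//; move=> /le_trans; apply.
  by rewrite -mulrnAl mulrAC.
(* the bounds are uniform for times up to t + 1, hence near t *)
have cx : continuous x.
  move=> t; apply/cvgrPdist_le => e e0.
  pose M := expR (2 * L * (Num.max t 0 + 1)).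
  have [k _ /(_ k (leqnn k)) kP] :=
    near_geometric_lt (a *+ 2 * M) (divr_gt0 e0 (ltr0n _ 3)).
  have umax : {for t, continuous (fun s : K => u k (Num.max s 0))}.
    exact: continuous_comp (@continuous_maxr0 K t) (cu k _).
  have xu (s : K) : Num.max s 0 <= Num.max t 0 + 1 ->
      `|x s - u k (Num.max s 0)| <= e / 3.
    move=> st; rewrite distrC (le_trans (xP s k))//.
    rewrite (le_trans _ (ltW kP))// ler_wpM2r ?invr_ge0 ?exprn_ge0//.
    rewrite -mulrnAl ler_wpM2l ?mulrn_wge0// ler_expR ler_wpM2l//.
    by rewrite mulr_ge0// ltW.
  near=> s.
  rewrite -(subrKA (u k (Num.max t 0))) (le_trans (ler_normD _ _))//.
  rewrite -(subrKA (u k (Num.max s 0)) _ (- x s)).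
  have -> : e = e / 3 + (e / 3 + e / 3) by field.
  rewrite lerD//; first by apply: xu; rewrite lerDl.
  rewrite (le_trans (ler_normD _ _))// lerD//.
    near: s; apply: cvgr_dist_le umax _ _; by rewrite divr_gt0.
  rewrite distrC; apply: xu; rewrite -lerBlDl.
  near: s; have := @continuous_maxr0 K t.
  move=> /cvgrPdist_le /(_ 1 ltr01); apply: filterS => s.
  by apply: le_trans; rewrite -normrN opprB ler_norm.
have [y yP] := exists_picard_step x0 cg cx.
have yx (t : K) : 0 <= t -> y t = x t.
  move=> t0; apply/eqP; rewrite -subr_eq0 -normr_le0; apply/ler_addgt0Pr => e e0.
  rewrite add0r; have [k _ /(_ k (leqnn k)) kP] :=
    near_geometric_lt (a *+ 2 * expR (2 * L * t)) e0.
  have yu := picard_step_contraction L0 gL (uP k) yP (ux k) t0.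
  have xu := ux k.+1 t t0.
  rewrite -(subrKA (u k.+1 t)) (le_trans (ler_normD _ _))// distrC.
  rewrite (le_trans (lerD yu xu))// (le_trans _ (ltW kP))//.
  rewrite le_eqVlt; apply/orP; left; apply/eqP; rewrite exprS; field.
  by rewrite expf_neq0.
exists y; have [cy y0 Dy] := yP; split=> // t t0.
by rewrite (yx t (ltW t0)); exact: Dy.
Unshelve. all: by end_near. Qed.

(** * Functions along solutions and invariant sublevel sets *)

(** The Lie derivative of V along f, usually written V with a dot. *)
Definition orbital_derivative (K : realType) (n : nat)
    (f : 'rV[K]_n -> 'rV[K]_n) (V : 'rV[K]_n -> K) (x : 'rV[K]_n) : K :=
  inner (gradient V x) (f x).

Lemma orbital_derivative_at0 (K : realType) (n : nat)
    (f : 'rV[K]_n -> 'rV[K]_n) (V : 'rV[K]_n -> K) :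
  f 0 = 0 -> orbital_derivative f V 0 = 0.
Proof.
move=> f0; rewrite /orbital_derivative /inner f0 big1// => i _.
by rewrite [X in _ * X]mxE mulr0.
Qed.

Lemma diff_inner_gradient (K : realType) (n : nat) (V : 'rV[K]_n -> K)
    (x v : 'rV[K]_n) :
  differentiable V x -> 'd V x v = inner (gradient V x) v.
Proof.
move=> dV; rewrite [in LHS](row_sum_delta v) linear_sum/=.
apply: eq_bigr => i _; rewrite linearZ/= mxE deriveE//.
exact: mulrC.
Qed.

Lemma cvg_inner (K : realType) (n : nat) (T : Type) (F : set_system T)
    (u v : T -> 'rV[K]_n) (a b : 'rV[K]_n) : Filter F ->
  u @ F --> a -> v @ F --> b ->
  (fun t => inner (u t) (v t)) @ F --> inner a b.
Proof.
move=> FF ua vb; apply: cvg_big => [|i _]; first exact: add_continuous.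
by apply: cvgM; [move: ua|move: vb] => wc;
  exact: (cvg_comp _ _ wc (@coord_continuous K 1 n ord0 i _)).
Qed.

Lemma continuous_orbital_derivative (K : realType) (n : nat)
    (f : 'rV[K]_n -> 'rV[K]_n) (V : 'rV[K]_n -> K) (x : 'rV[K]_n) :
  {for x, continuous (gradient V)} -> {for x, continuous f} ->
  {for x, continuous (orbital_derivative f V)}.
Proof.
by move=> cV cf; exact: (@cvg_inner K n 'rV[K]_n (nbhs x) _ _ _ _ _ cV cf).
Qed.

Lemma is_derive_along (K : realType) (n : nat) (V : 'rV[K]_n -> K)
    (x : K -> 'rV[K]_n) (t : K) (v : 'rV[K]_n) :
  is_derive t 1 x v -> differentiable V (x t) ->
  is_derive t 1 (V \o x) (inner (gradient V (x t)) v).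
Proof.
move=> [/derivable1_diffP dx xv] dV.
have dVx : differentiable (V \o x) t by exact: differentiable_comp.
split; first exact/derivable1_diffP.
by rewrite deriveE// diff_comp//= -(deriveE _ dx) xv diff_inner_gradient.
Qed.

Section along_a_solution.
Context (K : realType) (n : nat) (f : 'rV[K]_n -> 'rV[K]_n)
  (D : set 'rV[K]_n) (x0 : 'rV[K]_n) (T : K) (x : K -> 'rV[K]_n).
Hypothesis xsol : is_solution f D x0 T x.

Lemma near_solution (t : K) (P : set 'rV[K]_n) : t \in `[0, T] ->
  nbhs (x t) P ->
  exists2 d : K, 0 < d & forall s, s \in `[0, T] -> `|t - s| < d -> P (x s).
Proof.
have [_ _ /subspace_continuousP cx _] := xsol => tT Pt.
have [d d0 dP] := cx t tT P Pt.
by exists d => // s sT ts; apply: dP.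
Qed.

Lemma mean_value_along (V : 'rV[K]_n -> K) (a b : K) :
  0 <= a -> a < b -> b <= T ->
  (forall s, s \in `[a, b] -> differentiable V (x s)) ->
  exists2 c, c \in `]a, b[ &
    V (x b) - V (x a) = orbital_derivative f V (x c) * (b - a).
Proof.
move=> a0 ab bT dV; have [_ _ /subspace_continuousP cx Dx] := xsol.
have sub s : s \in `[a, b] -> s \in `[0, T].
  by rewrite !in_itv/= => /andP[/(le_trans a0)-> /le_trans->].
have Dh s : s \in `]a, b[ ->
    is_derive s 1 (V \o x) (orbital_derivative f V (x s)).
  move=> /[dup] sab; rewrite in_itv/= => /andP[sa sb].
  apply: is_derive_along; last by apply: dV; rewrite in_itv/= !ltW.
  by apply: Dx; rewrite in_itv/= (le_lt_trans a0 sa) (lt_le_trans sb bT).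
have ch : {within `[a, b], continuous (V \o x)}.
  apply/subspace_continuousP => s sab.
  apply: cvg_comp; last exact: differentiable_continuous (dV s sab).
  apply: cvg_trans (cx s (sub s sab)).
  apply: cvg_app => P [d d0 dP]; exists d => // r rd rab; apply: dP => //.
  exact: sub.
exact: MVT ab Dh ch.
Qed.

(** Being about any two times a < b near t, it serves both for leaving a sublevel
    set just after t and for reaching its level set from before t. *)
Lemma decrease_near (V : 'rV[K]_n -> K) (t : K) : t \in `[0, T] ->
  (forall y, differentiable V y) ->
  {for x t, continuous (orbital_derivative f V)} ->
  orbital_derivative f V (x t) < 0 ->
  exists2 d : K, 0 < d & forall a b, a \in `[0, T] -> b \in `[0, T] ->
    `|t - a| < d -> `|t - b| < d -> a < b -> V (x b) < V (x a).
Proof.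
move=> tT dV cV Vt.
have [d d0 dP] := near_solution tT (cvgr_lt _ cV 0 Vt).
exists d => // a b aT bT ta tb ab; move: (aT) (bT); rewrite !in_itv/=.
move=> /andP[a0 _] /andP[_ bT'].
have [c cab VE] := mean_value_along a0 ab bT' (fun s _ => dV (x s)).
rewrite -subr_lt0 VE nmulr_rlt0 ?subr_gt0//.
move: cab; rewrite in_itv/= => /andP[ac cb].
apply: dP; first by rewrite in_itv/= (le_trans a0 (ltW ac)) (le_trans (ltW cb) bT').
by move: ta tb; rewrite !ltr_norml; lra.
Qed.

End along_a_solution.

Lemma boundary_sublevel (K : realType) (n : nat) (R : 'rV[K]_n -> K) (c : K)
    (x : 'rV[K]_n) : continuous R -> boundary (sublevel R c) x -> R x = c.
Proof.
move=> cR [].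
have cE : closed (sublevel R c).
  exact: (@preimage_closed _ _ R [set r | r <= c]).
rewrite -(closure_id _).1// => Rc nint; apply/eqP; rewrite eq_le Rc/= leNgt.
apply/negP => xc; apply: nint; rewrite /interior.
apply: (@filterS _ (nbhs x) (nbhs_filter x) [set y | R y < c]).
  by move=> y /ltW.
exact: cvgr_lt (cR x) _ xc.
Qed.

(** At the supremum m of the times spent in the set the trajectory is on the
    boundary, where R strictly decreases; so R stays below c shortly after m.  The
    sign condition involves f on the boundary only, so it passes to any continuous
    field that agrees with f on the set. *)
Theorem sublevel_invariant (K : realType) (n : nat) (f : 'rV[K]_n -> 'rV[K]_n)
    (D : set 'rV[K]_n) (R : 'rV[K]_n -> K) (c : K)
    (x0 : 'rV[K]_n) (T : K) (x : K -> 'rV[K]_n) :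
  (forall y, D y -> {for y, continuous f}) ->
  continuously_differentiable setT R ->
  (forall y, boundary (sublevel R c) y -> orbital_derivative f R y < 0) ->
  sublevel R c x0 -> is_solution f D x0 T x ->
  forall t, t \in `[0, T] -> sublevel R c (x t).
Proof.
move=> cf R1 Rb Rx0 xsol t1 t1T; have [xx0 xD _ _] := xsol.
have dR y : differentiable R y by have [] := R1 y I.
have cR : continuous R by move=> y; exact: differentiable_continuous.
rewrite /sublevel/= leNgt; apply/negP => Rt1.
move: (t1T); rewrite in_itv/= => /andP[t10 t1T'].
pose S := [set t | 0 <= t <= t1 /\ R (x t) <= c].
have S0 : S 0 by split; [rewrite lexx|rewrite xx0].
have supS : has_sup S by split; [exists 0|exists t1 => t [/andP[]]].
pose m := sup S.
have m0 : 0 <= m by exact: sup_upper_bound.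
have mt1 : m <= t1 by apply: sup_le_ub; [exists 0|move=> t [/andP[]]].
have mT : m \in `[0, T] by rewrite in_itv/= m0 (le_trans mt1).
have Rm : R (x m) <= c.
  rewrite leNgt; apply/negP => Rm.
  have [d d0 dP] := near_solution xsol mT (cvgr_gt _ (cR (x m)) c Rm).
  have [s Ss ms] := sup_adherent d0 supS.
  have sm : s <= m by exact: sup_upper_bound.
  have [/andP[s0 st1] Rs] := Ss.
  have : R (x s) > c.
    apply: dP; first by rewrite in_itv/= s0 (le_trans st1).
    by rewrite ger0_norm ?subr_ge0// ltrBlDr -ltrBlDl.
  by rewrite ltNge Rs.
have {}mt1 : m < t1.
  by rewrite lt_neqAle mt1 andbT; apply: contraTneq Rt1 => <-; rewrite -leNgt.
(* just after the exit time m the trajectory is outside the sublevel set *)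
have after (d : K) : 0 < d ->
    exists s, [/\ m < s, s \in `[0, T], `|m - s| < d & c < R (x s)].
  move=> d0; pose s := m + Num.min (d / 2) (t1 - m).
  have ms : m < s by rewrite ltrDl lt_min divr_gt0// subr_gt0.
  have st1 : s <= t1 by rewrite -lerBrDl ge_min lexx orbT.
  exists s; split=> //.
  - by rewrite in_itv/= (le_trans m0 (ltW ms)) (le_trans st1).
  - rewrite distrC gtr0_norm ?subr_gt0// addrC addKr gt_min.
    by rewrite ltr_pdivrMr// ltr_pMr// ltr1n.
  - rewrite ltNge; apply/negP => Rs; move: ms; apply/negP; rewrite -leNgt.
    by apply: sup_upper_bound => //; split=> //; rewrite (le_trans m0 (ltW _))//
      ltrDl lt_min divr_gt0// subr_gt0.
have bm : boundary (sublevel R c) (x m).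
  split; first exact: subset_closure.
  move=> /(near_solution xsol mT)[d d0 dP].
  have [s [_ sT sd]] := after d d0.
  by rewrite ltNge (dP s sT sd).
have cL : {for x m, continuous (orbital_derivative f R)}.
  apply: continuous_orbital_derivative; last exact/cf/xD.
  by have [] := R1 (x m) I.
have [d d0 dP] := decrease_near xsol mT dR cL (Rb _ bm).
have [s [ms sT sd Rs]] := after d d0.
have := dP m s mT sT _ sd ms; rewrite subrr normr0 => /(_ d0).
by rewrite ltNge (le_trans Rm (ltW Rs)).
Qed.

(** A first contact with {R = c} at time t > 0 is impossible: R decreases strictly
    through t, so R would exceed c shortly before t. *)
Lemma strict_sublevel_invariant (K : realType) (n : nat)
    (f : 'rV[K]_n -> 'rV[K]_n) (D : set 'rV[K]_n) (R : 'rV[K]_n -> K) (c : K)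
    (x0 : 'rV[K]_n) (T : K) (x : K -> 'rV[K]_n) :
  (forall y, D y -> {for y, continuous f}) ->
  continuously_differentiable setT R ->
  (forall y, R y = c -> orbital_derivative f R y < 0) ->
  strict_sublevel R c x0 -> is_solution f D x0 T x ->
  forall t, t \in `[0, T] -> strict_sublevel R c (x t).
Proof.
move=> cf R1 Rc Rx0 xsol t tT; have [xx0 xD _ _] := xsol.
have dR y : differentiable R y by have [] := R1 y I.
have cR : continuous R by move=> y; exact: differentiable_continuous.
have xE : forall s, s \in `[0, T] -> sublevel R c (x s).
  apply: (sublevel_invariant cf R1 _ (ltW Rx0) xsol) => y yb.
  exact/Rc/(boundary_sublevel cR yb).
rewrite /strict_sublevel/= lt_neqAle xE// andbT; apply/eqP => Rt.
move: (tT); rewrite in_itv/= le_eqVlt => /andP[/predU1P[t0|t0] tT'].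
  by move: Rx0; rewrite /strict_sublevel/= -xx0 t0 Rt ltxx.
have cL : {for x t, continuous (orbital_derivative f R)}.
  apply: continuous_orbital_derivative; last exact/cf/xD.
  by have [] := R1 (x t) I.
have [d d0 dP] := decrease_near xsol tT dR cL (Rc _ Rt).
pose s := t - Num.min (d / 2) t.
have st : s < t by rewrite ltrBlDr ltrDl lt_min divr_gt0.
have sT : s \in `[0, T].
  by rewrite in_itv/= subr_ge0 ge_min lexx orbT (le_trans (ltW st)).
have : R (x t) < R (x s).
  apply: dP => //; last by rewrite subrr normr0.
  rewrite gtr0_norm ?subr_gt0// opprB addrC subrK gt_min.
  by rewrite ltr_pdivrMr// ltr_pMr// ltr1n.
by rewrite Rt ltNge; move/negP; apply; exact: xE.
Qed.

(** * Convergence of trapped solutions *)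

Lemma continuous_cst_sub (K : realType) (T : topologicalType) (p : T -> K)
    (a : K) (y : T) :
  {for y, continuous p} -> {for y, continuous (fun z => a - p z)}.
Proof. by move=> cp; apply: cvgB => //; exact: cvg_cst. Qed.

(** Near each point of A the alternative holds for all small m, so compactness of A
    gives a common m.  Being an alternative, it avoids minimizing q over the part
    of A where p <= 0. *)
Lemma compact_gap (K : realType) (T : topologicalType) (A : set T)
    (p q : T -> K) :
  compact A -> (forall y, A y -> {for y, continuous p}) ->
  (forall y, A y -> {for y, continuous q}) ->
  (forall y, A y -> 0 < p y \/ 0 < q y) ->
  exists2 m : K, 0 < m & forall y, A y -> 0 < p y \/ m < q y.
Proof.
move=> /compact_near_coveringP cA cp cq pq.
have : \forall m \near (0 : K)^'+, A `<=` (fun y => 0 < p y \/ m < q y).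
  apply: cA => y Ay; have [py|qy] := pq y Ay.
    exists ([set z | 0 < p z], setT) => /=; last by move=> [z m] [/= pz _]; left.
    by split; [exact: cvgr_gt (cp y Ay) _ py|exact: filterT].
  have q20 : 0 < q y / 2 by rewrite divr_gt0.
  exists ([set z | q y / 2 < q z], [set m | m < q y / 2]) => /=.
    split; last exact: nbhs_right_lt.
    by apply: cvgr_gt (cq y Ay) _ _; rewrite ltr_pdivrMr// ltr_pMr// ltr1n.
  by move=> [z m] [/= qz mq]; right; exact: lt_trans qz.
have m0 : \forall m \near (0 : K)^'+, 0 < m by exact: nbhs_right_gt.
move=> mP; have [m [m0' mP']] := filter_ex (filterI m0 mP).
by exists m.
Qed.

(** The quantifier order matters: T0 = |V x0| / m serves all the solutions from x0
    at once, where - m bounds the orbital derivative on the part of A where V is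
    not small. *)
Theorem lyapunov_convergence (K : realType) (n : nat)
    (f : 'rV[K]_n -> 'rV[K]_n) (D A : set 'rV[K]_n) (V : 'rV[K]_n -> K)
    (x0 : 'rV[K]_n) (e : K) :
  f 0 = 0 -> compact A ->
  (forall y, A y -> differentiable V y) ->
  (forall y, A y -> {for y, continuous (orbital_derivative f V)}) ->
  V 0 = 0 ->
  (forall y, (A `\` [set 0]) y -> 0 < V y) ->
  (forall y, (A `\` [set 0]) y -> orbital_derivative f V y < 0) ->
  0 < e ->
  exists T0 : K, forall T x, T0 < T -> is_solution f D x0 T x ->
    (forall t, t \in `[0, T] -> A (x t)) -> `|x T| < e.
Proof.
move=> f0 cA dV cL V0 Vpos Lneg e0.
have cV y : A y -> {for y, continuous V}.
  by move=> /dV; exact: differentiable_continuous.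
have Vge0 y : A y -> 0 <= V y.
  move=> Ay; have [->|y0] := eqVneq y 0; first by rewrite V0.
  by apply/ltW/Vpos; split=> //; exact/eqP.
have Lle0 y : A y -> orbital_derivative f V y <= 0.
  move=> Ay; have [->|y0] := eqVneq y 0.
    by rewrite orbital_derivative_at0.
  by apply/ltW/Lneg; split=> //; exact/eqP.
have [||y Ay|c c0 cP] := @compact_gap K _ A (fun y => e - `|y|) V cA.
- by move=> y _; apply: continuous_cst_sub; exact: (@norm_continuous K 'rV[K]_n y).
- by [].
- rewrite subr_gt0; have [->|y0] := eqVneq y 0; first by left; rewrite normr0.
  by right; apply: Vpos; split=> //; exact/eqP.
have [||y Ay|m m0 mP] :=
    @compact_gap K _ A (fun y => c - V y)
      (fun y => - orbital_derivative f V y) cA.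
- by move=> y Ay; apply: continuous_cst_sub; exact: cV.
- by move=> y Ay; apply: (@continuousN K K 'rV[K]_n); exact: cL.
- rewrite subr_gt0 oppr_gt0; have [->|y0] := eqVneq y 0; first by left; rewrite V0.
  by right; apply: Lneg; split=> //; exact/eqP.
exists (`|V x0| / m) => T x VT xsol xA.
have T0 : 0 < T by apply: le_lt_trans VT; rewrite divr_ge0// ltW.
have TT : T \in `[0, T] by rewrite in_itv/= lexx ltW.
have Adiff a s : 0 <= a -> s \in `[a, T] -> differentiable V (x s).
  move=> a0; rewrite in_itv/= => /andP[sa sT]; apply/dV/xA.
  by rewrite in_itv/= (le_trans a0 sa) sT.
have [//|xTc] := cP _ (xA _ TT); first by rewrite subr_gt0.
(* V does not increase along x, so it stays above c on the whole of [0, T] *)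
have Vc t : t \in `[0, T] -> c < V (x t).
  rewrite in_itv/= => /andP[t0]; rewrite le_eqVlt => /predU1P[->//|tT].
  have [s] := mean_value_along xsol t0 tT (lexx _) (fun s => @Adiff t s t0).
  rewrite in_itv/= => /andP[ts sT] VE.
  rewrite (lt_le_trans xTc)// -subr_le0 VE mulr_le0_ge0 ?subr_ge0 ?(ltW tT)//.
  by apply/Lle0/xA; rewrite in_itv/= (le_trans t0 (ltW ts)) ltW.
have [s] :=
  mean_value_along xsol (lexx 0) T0 (lexx _) (fun s => @Adiff 0 s (lexx 0)).
rewrite in_itv/= subr0 => /andP[s0 sT] VE.
have sI : s \in `[0, T] by rewrite in_itv/= !ltW.
have [xx0 _ _ _] := xsol.
have [|mL] := mP _ (xA s sI); first by rewrite subr_gt0 ltNge (ltW (Vc s sI)).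
have : V (x T) < 0.
  rewrite -(subrK (V (x 0)) (V (x T))) VE xx0.
  move: VT; rewrite ltr_pdivrMr// => VT.
  have : m * T < - orbital_derivative f V (x s) * T by rewrite ltr_pM2r.
  by have := ler_norm (V x0); lra.
by rewrite ltNge Vge0//; exact: xA.
Qed.

Section trapped_in_sublevel.
Context (K : realType) (n : nat) (f : 'rV[K]_n -> 'rV[K]_n)
  (D : set 'rV[K]_n) (R : 'rV[K]_n -> K) (c : K).
Hypotheses (D_open : open D) (f_lip : locally_lipschitz D f)
  (R_C1 : continuously_differentiable setT R)
  (E_sub : sublevel R c `<=` D) (E_compact : compact (sublevel R c))
  (R_boundary : forall y, boundary (sublevel R c) y ->
    orbital_derivative f R y < 0).

Let f_continuous y : D y -> {for y, continuous f}.
Proof. exact: locally_lipschitz_continuous. Qed.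

Lemma solution_in_sublevel x0 T x : sublevel R c x0 -> is_solution f D x0 T x ->
  forall t, t \in `[0, T] -> sublevel R c (x t).
Proof. exact: sublevel_invariant. Qed.

(** Solve for a global Lipschitz extension g of the restriction of f to the
    sublevel set: trapping, applied to g, shows that the solution only sees f. *)
Lemma exists_solution_in_sublevel x0 (T : K) : sublevel R c x0 ->
  exists x, is_solution f D x0 T x.
Proof.
move=> Ex0.
have [L L0 fL] := lipschitz_on_compact D_open f_lip E_sub E_compact.
have E0 : sublevel R c !=set0 by exists x0.
have [g [gf gL]] := lipschitz_extension (ltW L0) E0 fL.
have [x [cx xx0 Dx]] := exists_global_solution x0 L0 gL.
have xg : is_solution g setT x0 T x.
  split=> //; first exact: continuous_subspaceT.
  by move=> t; rewrite in_itv/= => /andP[t0 _]; exact: Dx.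
have cR : continuous R.
  by move=> y; have [dR _] := @R_C1 y I; exact: differentiable_continuous.
have xE : forall t, t \in `[0, T] -> sublevel R c (x t).
  apply: (@sublevel_invariant K n g setT R c x0 T x) => //.
  - by move=> y _; exact: (klipschitz_continuous gL).
  - move=> y yb; rewrite /orbital_derivative gf; first exact: R_boundary.
    by rewrite /sublevel/= (boundary_sublevel cR yb).
exists x; split=> //.
- by move=> t /xE; exact: E_sub.
- exact: continuous_subspaceT.
- move=> t tT; rewrite -gf; last by apply/xE/subset_itv_oo_cc.
  by move: tT; rewrite in_itv/= => /andP[t0 _]; exact: Dx.
Qed.

Lemma flow_definedT x0 t : sublevel R c x0 -> flow_defined f D t x0.
Proof.
by move=> /exists_solution_in_sublevel-/(_ t)[x xsol]; exists (x t); exists x.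
Qed.

Lemma flow_in_sublevel x0 t : 0 <= t -> sublevel R c x0 ->
  sublevel R c (flow f D t x0).
Proof.
move=> t0 Ex0; rewrite /flow; have [x xsol <-] := xgetPex 0 (flow_definedT t Ex0).
by apply: (solution_in_sublevel Ex0 xsol); rewrite in_itv/= t0 lexx.
Qed.

(** The flow picks a solution separately for each time; the estimate uniform over
    all the solutions makes the choices irrelevant. *)
Theorem lyapunov_attraction (A : set 'rV[K]_n) (V : 'rV[K]_n -> K) x0 :
  f 0 = 0 -> compact A ->
  (forall y, A y -> differentiable V y) ->
  (forall y, A y -> {for y, continuous (orbital_derivative f V)}) ->
  V 0 = 0 ->
  (forall y, (A `\` [set 0]) y -> 0 < V y) ->
  (forall y, (A `\` [set 0]) y -> orbital_derivative f V y < 0) ->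
  sublevel R c x0 ->
  (forall T x, is_solution f D x0 T x -> forall t, t \in `[0, T] -> A (x t)) ->
  region_of_attraction f D x0.
Proof.
move=> f0 cA dV cL V0 Vpos Lneg Ex0 xA; split=> [t _|]; first exact: flow_definedT.
apply/cvgrPdist_lt => e e0.
have [T0 T0P] := @lyapunov_convergence K n f D A V x0 e f0 cA dV cL V0 Vpos Lneg e0.
near=> t.
have [x xsol xt] := xgetPex 0 (flow_definedT t Ex0).
rewrite sub0r normrN /flow -xt; apply: T0P (xsol) (xA _ _ xsol).
by near: t; apply: nbhs_pinfty_gt; rewrite num_real.
Unshelve. all: by end_near. Qed.

End trapped_in_sublevel.

(** * The quotient VN / (gamma - R) and the region of attraction *)

Lemma derive_quotient (K : realType) (W : normedModType K) (p q : W -> K)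
    (y v : W) :
  derivable p y v -> derivable q y v -> q y != 0 ->
  'D_v (fun x => p x / q x) y =
  (q y) ^- 2 * (q y * 'D_v p y - p y * 'D_v q y).
Proof.
move=> dp dq q0; have dqV := derivableV q0 dq.
have -> : 'D_v (fun x => p x / q x) y = _ := deriveM dp dqV.
rewrite (deriveV q0 dq) /GRing.scale/=.
by field.
Qed.

Lemma derive_cst_sub (K : realType) (W : normedModType K) (q : W -> K) (c : K)
    (y v : W) :
  derivable q y v -> is_derive y v (fun x => c - q x) (- 'D_v q y).
Proof.
move=> dq; rewrite -[X in is_derive _ _ _ X]sub0r.
by apply: is_deriveB; exact: derivableP.
Qed.

(** The quotient rule, factored so as to exhibit the vector
    (c - R) grad V + V grad R. *)
Lemma gradient_quotient (K : realType) (n : nat) (V R : 'rV[K]_n -> K)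
    (c : K) (y : 'rV[K]_n) :
  differentiable V y -> differentiable R y -> c - R y != 0 ->
  gradient (fun x => V x / (c - R x)) y =
  (c - R y) ^- 2 *: ((c - R y) *: gradient V y + V y *: gradient R y).
Proof.
move=> dV dR cR; apply/rowP => i; rewrite !mxE; set v := delta_mx _ _.
have DV : derivable V y v by exact: diff_derivable.
have DR : derivable R y v by exact: diff_derivable.
have [dcR DcR] := derive_cst_sub c DR.
rewrite (@derive_quotient K _ V (fun x => c - R x) y v DV dcR cR).
by rewrite DcR mulrN opprK.
Qed.

Lemma differentiable_quotient (K : realType) (W : normedModType K) (p q : W -> K)
    (y : W) :
  differentiable p y -> differentiable q y -> q y != 0 ->
  differentiable (fun x => p x / q x) y.
Proof.
by move=> dp dq q0; apply: differentiableM => //; exact: differentiableV.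
Qed.

Lemma differentiable_cst_sub (K : realType) (W : normedModType K) (q : W -> K)
    (c : K) (y : W) :
  differentiable q y -> differentiable (fun x => c - q x) y.
Proof. by move=> dq; apply: differentiableB => //; exact: differentiable_cst. Qed.

Lemma inner_scalel (K : realType) (n : nat) (a : K) (u v : 'rV[K]_n) :
  inner (a *: u) v = a * inner u v.
Proof. by rewrite /inner mulr_sumr; apply: eq_bigr => i _; rewrite mxE mulrA. Qed.

Lemma inner_addl (K : realType) (n : nat) (u w v : 'rV[K]_n) :
  inner (u + w) v = inner u v + inner w v.
Proof.
by rewrite /inner -big_split; apply: eq_bigr => i _; rewrite mxE mulrDl.
Qed.

Lemma continuous_quotient_rule (K : realType) (T : topologicalType)
    (W : normedModType K) (p q : T -> K) (u v : T -> W) (y : T) :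
  {for y, continuous p} -> p y != 0 -> {for y, continuous q} ->
  {for y, continuous u} -> {for y, continuous v} ->
  {for y, continuous (fun z => p z ^- 2 *: (p z *: u z + q z *: v z))}.
Proof.
move=> cp p0 cq cu cv; apply: cvgZ; last by apply: cvgD; exact: cvgZ.
by apply: cvgV; [rewrite expf_neq0|rewrite expr2; exact: cvgM].
Qed.

Lemma continuously_differentiable_quotient (K : realType) (n : nat)
    (V R : 'rV[K]_n -> K) (c : K) :
  continuously_differentiable setT V -> continuously_differentiable setT R ->
  continuously_differentiable (strict_sublevel R c) (fun x => V x / (c - R x)).
Proof.
move=> V1 R1 y yc.
have dV z : differentiable V z by have [] := V1 z I.
have dR z : differentiable R z by have [] := R1 z I.
have cV : {for y, continuous V} by exact: differentiable_continuous.
have cR : {for y, continuous R} by exact: differentiable_continuous.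
have cR0 z : strict_sublevel R c z -> c - R z != 0.
  by rewrite /strict_sublevel/= -subr_gt0 => /gt_eqF->.
split.
  apply: (@differentiable_quotient K _ V (fun x => c - R x)) => //.
    exact: differentiable_cst_sub.
  exact: cR0.
pose G (z : 'rV[K]_n) :=
  (c - R z) ^- 2 *: ((c - R z) *: gradient V z + V z *: gradient R z).
have cG : {for y, continuous G}.
  apply: (@continuous_quotient_rule K 'rV[K]_n 'rV[K]_n (fun z => c - R z) V) => //.
  - exact: continuous_cst_sub.
  - exact: cR0.
  - by have [] := V1 y I.
  - by have [] := R1 y I.
have yG : \near y, G y = gradient (fun x => V x / (c - R x)) y.
  apply: (@filterS _ (nbhs y) (nbhs_filter y) (strict_sublevel R c)).
    by move=> z zc; rewrite /G gradient_quotient//; exact: cR0.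
  exact: cvgr_lt cR _ yc.
have Gy : G y = gradient (fun x => V x / (c - R x)) y by exact: nbhs_singleton yG.
have cg : gradient (fun x => V x / (c - R x)) z @[z --> y] --> G y.
  apply: cvg_trans cG; exact: (@near_eq_cvg _ _ (nbhs y) (nbhs_filter y)).
by rewrite Gy in cg.
Qed.

Lemma lyapunov_quotient (K : realType) (n : nat) (f : 'rV[K]_n -> 'rV[K]_n)
    (R VN : 'rV[K]_n -> K) (c : K) :
  continuously_differentiable setT R -> continuously_differentiable setT VN ->
  VN 0 = 0 ->
  (forall x, (sublevel R c `\` [set 0]) x -> 0 < VN x) ->
  (forall x, (sublevel R c `\` [set 0]) x ->
     0 < - inner ((c - R x) *: gradient VN x + VN x *: gradient R x) (f x)) ->
  is_lyapunov f (strict_sublevel R c) (fun x => VN x / (c - R x)).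
Proof.
move=> R1 V1 V0 Vpos Vneg; split.
- exact: continuously_differentiable_quotient.
- by rewrite V0 mul0r.
- move=> x [xc x0].
  have xE : (sublevel R c `\` [set 0]) x by split=> //; exact: ltW.
  have cR : 0 < c - R x by rewrite subr_gt0.
  split; first by rewrite divr_gt0// Vpos.
  rewrite gradient_quotient ?(gt_eqF cR)//; last 2 first.
  + by have [] := V1 x I.
  + by have [] := R1 x I.
  by rewrite inner_scalel pmulr_rlt0 -?oppr_gt0 ?Vneg// invr_gt0 exprn_gt0.
Qed.

Theorem theorem1 (K : realType) (n : nat)
    (D : set 'rV[K]_n) (f : 'rV[K]_n -> 'rV[K]_n)
    (D_open : open D) (D_connected : connected D) (D0 : D 0)
    (f_lip : locally_lipschitz D f) (f0 : f 0 = 0)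
    (R : 'rV[K]_n -> K) (gamma : K)
    (R_C1 : continuously_differentiable setT R) (gamma_gt0 : 0 < gamma)
    (E_sub : sublevel R gamma `<=` D) (E_compact : compact (sublevel R gamma))
    (E0 : sublevel R gamma 0) :
  ((forall x, boundary (sublevel R gamma) x ->
      0 < - inner (gradient R x) (f x)) ->
   (exists VN : 'rV[K]_n -> K,
      [/\ continuously_differentiable setT VN,
          VN 0 = 0,
          forall x, (sublevel R gamma `\` [set 0]) x -> 0 < VN x &
          forall x, (sublevel R gamma `\` [set 0]) x ->
            0 < - inner (gradient VN x) (f x)]) ->
   forall x0, sublevel R gamma x0 ->
   forall t', 0 <= t' ->
     flow_defined f D t' x0 /\ region_of_attraction f D (flow f D t' x0))
  /\
  (forall VN : 'rV[K]_n -> K,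
     continuously_differentiable setT VN ->
     VN 0 = 0 ->
     (forall x, (sublevel R gamma `\` [set 0]) x -> 0 < VN x) ->
     (forall x, (sublevel R gamma `\` [set 0]) x ->
        0 < - inner ((gamma - R x) *: gradient VN x + VN x *: gradient R x)
                    (f x)) ->
     (exists eps : K, 0 < eps /\
        ~ (sublevel R gamma `\` strict_sublevel R (gamma - eps)) 0) ->
     is_lyapunov f (strict_sublevel R gamma) (fun x => VN x / (gamma - R x)) /\
     strict_sublevel R gamma `<=` region_of_attraction f D).
Proof.
have f_cont y : D y -> {for y, continuous f}.
  exact: locally_lipschitz_continuous.
have R_diff y : differentiable R y by have [] := R_C1 y I.
have R_cont : continuous R by move=> y; exact: differentiable_continuous.
split.
- move=> R_in [VN [VN_C1 VN0 VNpos VNneg]] x0 Ex0 t t0.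
  have R_neg y : boundary (sublevel R gamma) y -> orbital_derivative f R y < 0.
    by move=> /R_in; rewrite oppr_gt0.
  split; first exact: (flow_definedT D_open f_lip R_C1 E_sub E_compact R_neg).
  have Et : sublevel R gamma (flow f D t x0).
    exact: (flow_in_sublevel D_open f_lip R_C1 E_sub E_compact R_neg).
  apply: (lyapunov_attraction D_open f_lip R_C1 E_sub E_compact R_neg
    (A := sublevel R gamma) (V := VN)) => //.
  + by move=> y _; have [] := VN_C1 y I.
  + move=> y Ey; apply: continuous_orbital_derivative; last exact/f_cont/E_sub.
    by have [] := VN_C1 y I.
  + by move=> y /VNneg; rewrite oppr_gt0.
  + move=> T x xsol.
    exact: (solution_in_sublevel D_open f_lip R_C1 R_neg Et xsol).
- move=> VN VN_C1 VN0 VNpos Vneg [eps [eps0 E0eps]].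
  have VN_cont : continuous VN.
    by move=> y; have [dVN _] := VN_C1 y I; exact: differentiable_continuous.
  have R0 : R 0 < gamma.
    rewrite ltNge; apply/negP => R0; apply: E0eps; split=> //.
    rewrite /strict_sublevel/= => /lt_trans-/(_ gamma); rewrite ltrBlDr ltrDl.
    by move=> /(_ eps0); rewrite ltNge R0.
  have V_lyap := lyapunov_quotient R_C1 VN_C1 VN0 VNpos Vneg.
  split=> // x0 x0E.
  have [V_C1 V0 VP] := V_lyap.
  set V := fun x => VN x / (gamma - R x) in V_lyap V_C1 V0 VP.
  (* on the level set R = gamma only the term with the gradient of R is left *)
  have R_neg y : R y = gamma -> orbital_derivative f R y < 0.
    move=> Ry; have yE : (sublevel R gamma `\` [set 0]) y.
      by split; [rewrite /sublevel/= Ry|move=> y0; move: R0; rewrite -y0 Ry ltxx].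
    have := Vneg y yE.
    rewrite inner_addl !inner_scalel Ry subrr mul0r add0r oppr_gt0.
    by rewrite pmulr_rlt0// VNpos.
  have Rb_neg y : boundary (sublevel R gamma) y -> orbital_derivative f R y < 0.
    by move=> /(boundary_sublevel R_cont)/R_neg.
  have barrier_cont : continuous (fun y => VN y - V x0 * (gamma - R y)).
    move=> y; apply: (@continuousB K K 'rV[K]_n VN); first exact: VN_cont.
    apply: (@continuousM K 'rV[K]_n (cst (V x0))); first exact: cst_continuous.
    by apply: continuous_cst_sub; exact: R_cont.
  (* {V <= V x0} cleared of its denominator, so that it is closed at R = gamma too *)
  pose A := sublevel R gamma `&` [set y | VN y - V x0 * (gamma - R y) <= 0].
  have A_strict y : A y -> strict_sublevel R gamma y.
    move=> [Ry VNy]; rewrite /strict_sublevel/= lt_neqAle Ry andbT; apply/eqP => Rg.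
    have y0 : y <> 0 by move=> y0; move: R0; rewrite -y0 Rg ltxx.
    have := VNpos y (conj Ry y0); move: VNy => /=.
    by rewrite Rg subrr mulr0 subr0 leNgt => /negbTE->.
  apply: (lyapunov_attraction D_open f_lip R_C1 E_sub E_compact Rb_neg
    (A := A) (V := V)) => //.
  + apply: compact_closedI => //.
    exact: (@preimage_closed _ _ (fun y => VN y - V x0 * (gamma - R y))
      [set r | r <= 0]).
  + by move=> y /A_strict/V_C1[].
  + move=> y Ay; apply: continuous_orbital_derivative.
      by have [] := V_C1 y (A_strict y Ay).
    by apply/f_cont/E_sub; case: Ay.
  + by move=> y [/A_strict Ay y0]; have [] := VP y (conj Ay y0).
  + by move=> y [/A_strict Ay y0]; have [] := VP y (conj Ay y0).
  + exact: ltW.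
  + move=> T x xsol t tT.
    have xE := strict_sublevel_invariant f_cont R_C1 R_neg x0E xsol.
    split; first exact/ltW/xE.
    have [xx0 _ _ _] := xsol.
    rewrite /= subr_le0 -ler_pdivrMr ?subr_gt0; last exact: xE.
    rewrite -[leLHS]/(V (x t)).
    move: (tT); rewrite in_itv/= => /andP[+ tT'].
    rewrite le_eqVlt => /predU1P[<-|t0]; first by rewrite xx0.
    have sub s : s \in `[0, t] -> s \in `[0, T].
      by rewrite !in_itv/= => /andP[-> /le_trans->].
    have [s|s] := mean_value_along (V := V) xsol (lexx 0) t0 tT'.
      by move=> /sub/xE/V_C1[].
    move=> s0t VE; rewrite -subr_le0 -xx0 VE mulr_le0_ge0 ?subr_ge0 ?(ltW t0)//.
    have {}s0t : strict_sublevel R gamma (x s).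
      by apply/xE/sub/subset_itv_oo_cc.
    have [->|xs0] := eqVneq (x s) 0.
      by rewrite orbital_derivative_at0.
    by apply/ltW; have [] := VP (x s) (conj s0t (elimN eqP xs0)).
Qed.
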